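(* Let $\mathcal{A}$ and $\mathcal{B}$ be $C^{*}$-algebras, let $\Xi$ be a Hilbert $\mathcal{A}$-module and $\nabla$ a Hilbert $\mathcal{B}$-module. Let $f:\Xi \rightarrow \nabla$ be a mapping for which there exists a function $\varphi:\Xi^{3}\rightarrow[0,\infty)$ such that $$\| f(\mu x+y)-\mu f(x)-f(y)\| \leq \varphi(x,y,0),$$ $$\| f(\langle x,y\rangle z)-\langle f(x),f(y)\rangle f(z)\| \leq \varphi(x,y,z),$$ $$\| f(\langle x,y\rangle^{*} z)-\langle f(x),f(y)\rangle^{*} f(z)\| \leq \varphi(x,y,z)$$ for all $x,y,z\in\Xi$ and all $\mu\in\mathbb{T}$. If there exists $0\leq L<1$ such that $\varphi(x,y,z)\leq \frac{L}{8}\varphi(2x,2y,2z)$ for all $x,y,z\in\Xi$, then there exists a unique Hilbert $C^{*}$-module $\ast$-homomorphism $H:\Xi\rightarrow\nabla$ such that $$\|f(x)-H(x)\|\leq \frac{L}{8-8L}\varphi(x,x,0)$$ for all $x\in\Xi$.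
   Context: $\mathbb{T}=\{z\in\mathbb{C}:|z|=1\}$. For a $C^{*}$-algebra $\mathcal{A}$, a (left) Hilbert $\mathcal{A}$-module is a complex linear space $\Xi$ with a compatible left $\mathcal{A}$-module action ($\lambda(ax)=(\lambda a)x=a(\lambda x)$) and a map $\langle\cdot,\cdot\rangle:\Xi\times\Xi\to\mathcal{A}$ that is linear in the first variable, satisfies $\langle ax,y\rangle=a\langle x,y\rangle$, $\langle x,y\rangle^{*}=\langle y,x\rangle$, $\langle x,x\rangle\geq 0$ with equality iff $x=0$, and such that $\Xi$ is complete in the norm $\|x\|=\|\langle x,x\rangle\|^{1/2}$. For a Hilbert $\mathcal{A}$-module $\Xi$ and a Hilbert $\mathcal{B}$-module $\nabla$, a Hilbert $C^{*}$-module homomorphism is a $\mathbb{C}$-linear map $H:\Xi\to\nabla$ with $H(\langle x,y\rangle z)=\langle H(x),H(y)\rangle H(z)$ for all $x,y,z\in\Xi$; it is a Hilbert $C^{*}$-module $\ast$-homomorphism if moreover $H(\langle x,y\rangle^{*} z)=\langle H(x),H(y)\rangle^{*} H(z)$ for all $x,y,z\in\Xi$. *)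

(* Defs.v *)
From HB Require Import structures.
From mathcomp Require Import all_boot all_order all_algebra.
From mathcomp Require Import all_classical reals.
From mathcomp Require Import complex.
Set Implicit Arguments. Unset Strict Implicit. Unset Printing Implicit Defensive.
Import Order.TTheory GRing.Theory Num.Theory.
Local Open Scope ring_scope.

Section Defs.
Variable R : realType.
Local Notation C := (R[i]).

Definition cabs (c : C) : R := ComplexField.Normc.normc c.

Definition is_norm (V : lmodType C) (nrm : V -> R) : Prop :=
  [/\ forall x, 0 <= nrm x,
      forall x, nrm x = 0 -> x = 0,
      forall x y, nrm (x + y) <= nrm x + nrm y &
      forall (c : C) x, nrm (c *: x) = cabs c * nrm x].

Definition complete_for (V : lmodType C) (nrm : V -> R) : Prop :=
  forall u : nat -> V,
    (forall e : R, 0 < e -> exists N : nat, forall m n : nat,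
        (N <= m)%N -> (N <= n)%N -> nrm (u m - u n) < e) ->
    exists l : V, forall e : R, 0 < e -> exists N : nat, forall n : nat,
        (N <= n)%N -> nrm (u n - l) < e.

(* A (not necessarily unital) C*-algebra *)
Record CstarAlg := {
  ca_car :> lmodType C;
  ca_mul : ca_car -> ca_car -> ca_car;
  ca_star : ca_car -> ca_car;
  ca_norm : ca_car -> R;
  ca_mulA : forall a b c, ca_mul a (ca_mul b c) = ca_mul (ca_mul a b) c;
  ca_mulDl : forall a b c, ca_mul (a + b) c = ca_mul a c + ca_mul b c;
  ca_mulDr : forall a b c, ca_mul a (b + c) = ca_mul a b + ca_mul a c;
  ca_mulZl : forall (l : C) a b, ca_mul (l *: a) b = l *: ca_mul a b;
  ca_mulZr : forall (l : C) a b, ca_mul a (l *: b) = l *: ca_mul a b;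
  ca_starD : forall a b, ca_star (a + b) = ca_star a + ca_star b;
  ca_starZ : forall (l : C) a, ca_star (l *: a) = Num.conj l *: ca_star a;
  ca_starK : forall a, ca_star (ca_star a) = a;
  ca_starM : forall a b, ca_star (ca_mul a b) = ca_mul (ca_star b) (ca_star a);
  ca_normP : is_norm ca_norm;
  ca_normM : forall a b, ca_norm (ca_mul a b) <= ca_norm a * ca_norm b;
  ca_normC : forall a, ca_norm (ca_mul (ca_star a) a) = ca_norm a ^+ 2;
  ca_complete : complete_for ca_norm
}.

Definition ca_pos (A : CstarAlg) (a : A) : Prop :=
  exists b : A, a = ca_mul (ca_star b) b.

Record HilbMod (A : CstarAlg) := {
  hm_car :> lmodType C;
  hm_act : A -> hm_car -> hm_car;
  hm_ip : hm_car -> hm_car -> A;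
  hm_actDl : forall (a b : A) x, hm_act (a + b) x = hm_act a x + hm_act b x;
  hm_actDr : forall (a : A) x y, hm_act a (x + y) = hm_act a x + hm_act a y;
  hm_actM : forall (a b : A) x, hm_act (ca_mul a b) x = hm_act a (hm_act b x);
  hm_actZl : forall (l : C) (a : A) x, hm_act (l *: a) x = l *: hm_act a x;
  hm_actZr : forall (l : C) (a : A) x, hm_act a (l *: x) = l *: hm_act a x;
  hm_ipDl : forall x y z, hm_ip (x + y) z = hm_ip x z + hm_ip y z;
  hm_ipZl : forall (l : C) x y, hm_ip (l *: x) y = l *: hm_ip x y;
  hm_ipA : forall (a : A) x y, hm_ip (hm_act a x) y = ca_mul a (hm_ip x y);
  hm_ipC : forall x y, ca_star (hm_ip x y) = hm_ip y x;
  hm_ip_pos : forall x, ca_pos (hm_ip x x);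
  hm_ip_def : forall x, hm_ip x x = 0 -> x = 0;
  hm_complete : complete_for (fun x => Num.sqrt (ca_norm (hm_ip x x)))
}.

Definition hnorm (A : CstarAlg) (X : HilbMod A) (x : X) : R :=
  Num.sqrt (ca_norm (hm_ip x x)).

Definition is_hm_hom (A B : CstarAlg) (X : HilbMod A) (Y : HilbMod B)
    (H : X -> Y) : Prop :=
  (forall (l : C) (x y : X), H (l *: x + y) = l *: H x + H y) /\
  (forall x y z : X,
     H (hm_act (hm_ip x y) z) = hm_act (hm_ip (H x) (H y)) (H z)).

Definition is_hm_star_hom (A B : CstarAlg) (X : HilbMod A) (Y : HilbMod B)
    (H : X -> Y) : Prop :=
  is_hm_hom H /\
  (forall x y z : X,
     H (hm_act (ca_star (hm_ip x y)) z)
     = hm_act (ca_star (hm_ip (H x) (H y))) (H z)).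

End Defs.

(* Main.v *)
(* The limit [H x] of [2^n f(x / 2^n)] exists because, with [q = L / 8], the
   increments are dominated by a geometric series of ratio [2 q]; it commutes
   with unimodular scalars, hence with all complex scalars, and the module
   identities pass to the limit because their defect, rescaled by [8^n], is at
   most [(8 q)^n phi x y z].
   That [hnorm] is a norm is where the work lies: it rests on the
   Cauchy-Schwarz inequality, hence on positivity in C*-algebras. In the
   unitization, call a self-adjoint [h] positive if [||t - h|| <= t] for some
   [t >= 0]; such elements obviously form a convex cone. The Visser iteration
   [s_(n+1) = (x + s_n^2) / 2] gives [1 - sqrt (1 - x)], hence square roots, and
   commuting self-adjoint [k, w] with [k^2 + w^2 = t^2] satisfy [||k|| <= t]
   because [k + i w] is [t] times a unitary. This makes squares of self-adjoint
   elements positive and the norm monotone on the cone, and yields Kaplansky's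
   theorem that every [c^* c] is positive. *)

Require Import Defs.
From HB Require Import structures.
From mathcomp Require Import all_boot all_order all_algebra.
From mathcomp Require Import all_classical reals topology normedtype sequences.
From mathcomp Require Import complex.
From mathcomp Require Import ring lra.
Set Implicit Arguments.
Unset Strict Implicit.
Unset Printing Implicit Defensive.
Import Order.TTheory GRing.Theory Num.Theory numFieldNormedType.Exports.
Local Open Scope classical_set_scope.
Local Open Scope ring_scope.
Local Open Scope complex_scope.

Section ComplexModulus.
Variable R : realType.
Implicit Types c d : R[i].

Lemma cabsE c : `|c| = (cabs c)%:C.
Proof. by case: c => a b; rewrite normc_def. Qed.

Lemma cabs0 : cabs (0 : R[i]) = 0.
Proof. exact: ComplexField.Normc.normc0. Qed.

Lemma cabs1 : cabs (1 : R[i]) = 1.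
Proof. exact: ComplexField.Normc.normc1. Qed.

Lemma cabsM c d : cabs (c * d) = cabs c * cabs d.
Proof. exact: ComplexField.Normc.normcM. Qed.

Lemma cabs_is_norm : is_norm (V := R[i]^o) (@cabs R).
Proof.
split.
- by move=> c; rewrite -ler0c -cabsE.
- exact: ComplexField.Normc.eq0_normc.
- exact: le_normcD.
- exact: cabsM.
Qed.

Lemma cabs_ge0 c : 0 <= cabs c.
Proof. by case: cabs_is_norm. Qed.

Lemma cabs_eq0 c : (cabs c == 0) = (c == 0).
Proof.
by apply/eqP/eqP => [/ComplexField.Normc.eq0_normc|->]; last exact: cabs0.
Qed.

Lemma cabsV c : cabs c^-1 = (cabs c)^-1.
Proof. exact: ComplexField.Normc.normcV. Qed.

Lemma cabs_real (r : R) : cabs r%:C = `|r|.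
Proof. by rewrite /cabs /= expr0n addr0 sqrtr_sqr. Qed.

Lemma cabs_nat n : cabs (n%:R : R[i]) = n%:R.
Proof. by rewrite -(rmorph_nat (@real_complex R)) cabs_real normr_nat. Qed.

Lemma cabsJ c : cabs (Num.conj c) = cabs c.
Proof. by apply: (@complexI R); rewrite -!cabsE norm_conjC. Qed.

Lemma cabsi : cabs ('i : R[i]) = 1.
Proof. by apply: (@complexI R); rewrite -cabsE normCi. Qed.

Lemma normr_Re_le_cabs c : `|complex.Re c| <= cabs c.
Proof. by rewrite -lecR -cabsE normc_ge_Re. Qed.

Lemma normr_Im_le_cabs c : `|complex.Im c| <= cabs c.
Proof.
case: c => a b; rewrite /cabs /= -sqrtr_sqr ler_sqrt ?lerDr ?sqr_ge0 //.
by rewrite addr_ge0 ?sqr_ge0.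
Qed.

Lemma cabs_le_ReIm c : cabs c <= `|complex.Re c| + `|complex.Im c|.
Proof.
rewrite {1}(complexE c); apply: le_trans (le_normcD _ _) _.
by rewrite -/(cabs _) -/(cabs _) cabsM cabsi mul1r !cabs_real.
Qed.

Lemma conj_real (r : R) : Num.conj r%:C = r%:C.
Proof. by apply/CrealP; apply/complex_realP; exists r. Qed.

Lemma real_sum_unimodular (r : R) : `|r| <= 2 ->
  exists mu nu : R[i], [/\ cabs mu = 1, cabs nu = 1 & r%:C = mu + nu].
Proof.
rewrite ler_norml => /andP[r_ge r_le].
pose s := Num.sqrt (1 - (r / 2) ^+ 2).
have s2 : s ^+ 2 = 1 - (r / 2) ^+ 2.
  by rewrite sqr_sqrtr //; nra.
exists (r / 2 +i* s), (r / 2 +i* (- s)); split.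
- by rewrite /cabs /= s2 subrKC sqrtr1.
- by rewrite /cabs /= sqrrN s2 subrKC sqrtr1.
- by apply/eqP; rewrite eq_complex /= -splitr subrr !eqxx.
Qed.

Lemma scale_half_addr (V : lmodType R[i]) (x : V) : (2^-1)%:C *: (x + x) = x.
Proof.
by rewrite scalerDr -scalerDl -rmorphD /= -[_^-1]div1r -splitr scale1r.
Qed.

End ComplexModulus.

Section NormedLimits.
Variables (R : realType) (V : lmodType R[i]) (nrm : V -> R).
Hypothesis nrmP : is_norm nrm.
Implicit Types (u v : nat -> V) (x y z : V) (d : nat -> R).

Lemma nrm_ge0 x : 0 <= nrm x. Proof. by case: nrmP. Qed.

Lemma nrm_eq0 x : nrm x = 0 -> x = 0.
Proof. by case: nrmP => _ + _ _; exact. Qed.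

Lemma nrm_gt0 x : x != 0 -> 0 < nrm x.
Proof.
by move=> x0; rewrite lt_def nrm_ge0 andbT; apply: contra_neq x0 => /nrm_eq0.
Qed.

Lemma ler_nrmD x y : nrm (x + y) <= nrm x + nrm y. Proof. by case: nrmP. Qed.

Lemma nrmZ c x : nrm (c *: x) = cabs c * nrm x. Proof. by case: nrmP. Qed.

Lemma nrmZ_real (r : R) x : 0 <= r -> nrm (r%:C *: x) = r * nrm x.
Proof. by move=> r0; rewrite nrmZ cabs_real ger0_norm. Qed.

Lemma nrm0 : nrm 0 = 0.
Proof. by rewrite -(scale0r 0) nrmZ cabs0 mul0r. Qed.

Lemma nrmN x : nrm (- x) = nrm x.
Proof. by rewrite -scaleN1r nrmZ /cabs normcN -/(cabs 1) cabs1 mul1r. Qed.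

Lemma nrm_distC x y : nrm (x - y) = nrm (y - x).
Proof. by rewrite -nrmN opprB. Qed.

Lemma ler_nrmB x y : nrm (x - y) <= nrm x + nrm y.
Proof. by rewrite -(nrmN y) ler_nrmD. Qed.

Lemma ler_nrm_distD y x z : nrm (x - z) <= nrm (x - y) + nrm (y - z).
Proof. by rewrite -[x - z](subrKA y) ler_nrmD. Qed.

Definition ncvg u x := nrm (u n - x) @[n --> \oo] --> (0 : R).

Lemma ncvgP u x : ncvg u x <->
  forall e, 0 < e -> exists N, forall n, (N <= n)%N -> nrm (u n - x) < e.
Proof.
split=> [/cvgr0Pnorm_lt ux e /ux[N _ ux_lt]|ux].
  by exists N => n /ux_lt; rewrite ger0_norm ?nrm_ge0.
apply/cvgr0Pnorm_lt => e /ux[N ux_lt]; exists N => // n /ux_lt.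
by rewrite /= ger0_norm ?nrm_ge0.
Qed.

Lemma ncvg_cst x : ncvg (fun=> x) x.
Proof. by rewrite /ncvg subrr nrm0; exact: cvg_cst. Qed.

Lemma ncvg_le_dist u x d : d @ \oo --> (0 : R) ->
  (forall n, nrm (u n - x) <= d n) -> ncvg u x.
Proof.
move=> d0 ux_le; apply: squeeze_cvgr (cvg_cst 0) d0.
by apply: nearW => n; rewrite nrm_ge0 ux_le.
Qed.

Lemma ncvg_dist_le u v x y d (r : R) : ncvg u x -> ncvg v y -> d @ \oo --> r ->
  (forall n, nrm (u n - v n) <= d n) -> nrm (x - y) <= r.
Proof.
rewrite /ncvg => ux vy dr uv_le.
have bound_cvg : nrm (u n - x) + d n + nrm (v n - y) @[n --> \oo] --> r.
  by rewrite -[r]add0r -[0 + r]addr0; apply: cvgD vy; exact: cvgD ux dr.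
apply: (cvgr_to_ge bound_cvg); apply: nearW => n.
apply: le_trans (ler_nrm_distD (v n) _ _) _; rewrite lerD2r.
apply: le_trans (ler_nrm_distD (u n) _ _) _.
by rewrite nrm_distC lerD2l.
Qed.

Lemma ncvg_eq u v x y d : ncvg u x -> ncvg v y -> d @ \oo --> (0 : R) ->
  (forall n, nrm (u n - v n) <= d n) -> x = y.
Proof.
move=> ux vy d0 uv_le; apply/subr0_eq/nrm_eq0/le_anti.
by rewrite (ncvg_dist_le ux vy d0 uv_le) nrm_ge0.
Qed.

Lemma ncvg_unique u x y : ncvg u x -> ncvg u y -> x = y.
Proof.
by move=> ux uy; apply: (ncvg_eq ux uy (cvg_cst 0)) => n; rewrite subrr nrm0.
Qed.

Lemma ncvg_subseq u x (k : nat -> nat) : k @ \oo --> \oo ->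
  ncvg u x -> ncvg (u \o k) x.
Proof. by move=> k_oo; exact: (cvg_comp _ _ k_oo). Qed.

Lemma ncvgD u v x y : ncvg u x -> ncvg v y -> ncvg (fun n => u n + v n) (x + y).
Proof.
move=> ux vy.
apply: (ncvg_le_dist (d := fun n => nrm (u n - x) + nrm (v n - y))) => [|n].
  by rewrite -[0]addr0; exact: cvgD ux vy.
by rewrite opprD addrACA ler_nrmD.
Qed.

Lemma ncvgZ c u x : ncvg u x -> ncvg (fun n => c *: u n) (c *: x).
Proof.
move=> ux; apply: (ncvg_le_dist (d := fun n => cabs c * nrm (u n - x))) => [|n].
  by rewrite -(mulr0 (cabs c)); exact: cvgM (cvg_cst _) ux.
by rewrite -scalerBr nrmZ.
Qed.

Lemma dominated_increments_ncvg u d (r : R) : complete_for nrm ->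
  d @ \oo --> r -> (forall n, nrm (u n.+1 - u n) <= d n.+1 - d n) ->
  exists2 x, ncvg u x & nrm (x - u 0) <= r - d 0.
Proof.
move=> nrmC dr u_le.
have dist_le m n : (m <= n)%N -> nrm (u n - u m) <= d n - d m.
  move/subnKC <-; elim: (n - m)%N => [|k IH].
    by rewrite addn0 !subrr nrm0.
  rewrite addnS; apply: le_trans (ler_nrm_distD (u (m + k)) _ _) _.
  by rewrite -[leRHS](subrKA (d (m + k)%N)) lerD.
have [|x /ncvgP ux] := nrmC u.
  move=> e e0; have e20 : 0 < e / 2 by rewrite divr_gt0.
  have /cvgrPdist_lt/(_ _ e20)[N _ d_near] := dr.
  exists N => m n; wlog mn : m n / (m <= n)%N => [wlog_mn Nm Nn|Nm Nn].
    by case/orP: (leq_total m n) => /wlog_mn; last rewrite nrm_distC; apply.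
  rewrite nrm_distC; apply: le_lt_trans (dist_le _ _ mn) _.
  by move: (d_near _ Nm) (d_near _ Nn); rewrite !ltr_norml; lra.
exists x => //.
apply: ncvg_dist_le ux (ncvg_cst _) (cvgB dr (cvg_cst _)) _ => n.
exact: dist_le.
Qed.

End NormedLimits.

Lemma ncvg_bilinear (R : realType) (V1 V2 V3 : lmodType R[i]) (nrm1 : V1 -> R)
    (nrm2 : V2 -> R) (nrm3 : V3 -> R) (m : V1 -> V2 -> V3) u v x y :
  is_norm nrm1 -> is_norm nrm2 -> is_norm nrm3 ->
  (forall a b c, m (a + b) c = m a c + m b c) ->
  (forall a b c, m a (b + c) = m a b + m a c) ->
  (forall a b, nrm3 (m a b) <= nrm1 a * nrm2 b) ->
  ncvg nrm1 u x -> ncvg nrm2 v y -> ncvg nrm3 (fun n => m (u n) (v n)) (m x y).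
Proof.
rewrite /ncvg => nrm1P nrm2P nrm3P mDl mDr m_le ux vy.
have dist_cvg : nrm1 (u n - x) * nrm2 (v n - y) + nrm1 (u n - x) * nrm2 y
    + nrm1 x * nrm2 (v n - y) @[n --> \oo] --> 0 * 0 + 0 * nrm2 y + nrm1 x * 0.
  by apply: cvgD; [apply: cvgD|]; apply: cvgM => //; exact: cvg_cst.
rewrite !mul0r mulr0 !addr0 in dist_cvg.
apply: (ncvg_le_dist nrm3P dist_cvg) => n.
have -> : m (u n) (v n) - m x y
    = m (u n - x) (v n - y) + m (u n - x) y + m x (v n - y).
  rewrite -mDr subrK; apply/eqP; rewrite subr_eq -addrA -mDr subrK.
  by rewrite -mDl subrK.
apply: le_trans (ler_nrmD nrm3P _ _) _; apply: lerD => //.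
by apply: le_trans (ler_nrmD nrm3P _ _) _; exact: lerD.
Qed.

Section CompleteScalars.
Variable R : realType.

Lemma real_cauchy_cvg (u : nat -> R) :
  (forall e, 0 < e -> exists N, forall m n, (N <= m)%N -> (N <= n)%N ->
     `|u m - u n| < e) -> cvgn u.
Proof.
move=> u_cauchy; apply/cauchy_cvgP/cauchy_exP => e /u_cauchy[N u_near].
by exists (u N), N => // n Nn; exact: u_near.
Qed.

Lemma cabs_complete : complete_for (V := R[i]^o) (@cabs R).
Proof.
move=> u u_cauchy.
have re_cvg : cvgn (fun n => complex.Re (u n)).
  apply: real_cauchy_cvg => e /u_cauchy[N u_near]; exists N => m n Nm Nn.
  by apply: le_lt_trans (u_near _ _ Nm Nn); rewrite -raddfB normr_Re_le_cabs.
have im_cvg : cvgn (fun n => complex.Im (u n)).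
  apply: real_cauchy_cvg => e /u_cauchy[N u_near]; exists N => m n Nm Nn.
  by apply: le_lt_trans (u_near _ _ Nm Nn); rewrite -raddfB normr_Im_le_cabs.
have /cvg_ex[a re_a] := re_cvg; have /cvg_ex[b im_b] := im_cvg.
exists (a +i* b); apply/(ncvgP (cabs_is_norm R)).
have dist_cvg : `|complex.Re (u n) - a| + `|complex.Im (u n) - b|
    @[n --> \oo] --> `|a - a| + `|b - b|.
  by apply: cvgD; apply: cvg_norm; apply: cvgB => //; exact: cvg_cst.
rewrite !subrr normr0 addr0 in dist_cvg.
apply: (ncvg_le_dist (cabs_is_norm R) dist_cvg) => n.
by apply: le_trans (cabs_le_ReIm _) _; rewrite !raddfB.
Qed.

End CompleteScalars.

Lemma morphD_zmod_morphism (U V : zmodType) (f : U -> V) :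
  {morph f : x y / x + y} -> GRing.zmod_morphism f.
Proof.
by move=> fD x y; apply: (addIr (f y)); rewrite subrK -fD subrK.
Qed.

Lemma involution_isometry (R : realFieldType) (T : Type) (N : T -> R)
    (star : T -> T) : involutive star -> (forall x, 0 <= N x) ->
  (forall x, N x ^+ 2 <= N (star x) * N x) -> forall x, N (star x) = N x.
Proof.
move=> starK N_ge0 N_sqr_le.
have N_le x : N x <= N (star x).
  have [->|Nx_neq0] := eqVneq (N x) 0; first exact: N_ge0.
  by have := N_sqr_le x; rewrite expr2 ler_pM2r // lt_def Nx_neq0 N_ge0.
by move=> x; apply/le_anti; rewrite N_le andbT -{2}(starK x) N_le.
Qed.

HB.instance Definition _ (R : realType) (A : CstarAlg R) :=
  GRing.isZmodMorphism.Build A A (@ca_star R A)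
    (morphD_zmod_morphism (@ca_starD R A)).

Section CstarBasics.
Variables (R : realType) (A : CstarAlg R).
Implicit Types a b : A.

Lemma ca_mul0r a : ca_mul 0 a = 0.
Proof. by rewrite -{1}(scale0r (0 : A)) ca_mulZl scale0r. Qed.

Lemma ca_mulr0 a : ca_mul a 0 = 0.
Proof. by rewrite -{1}(scale0r (0 : A)) ca_mulZr scale0r. Qed.

Lemma ca_norm_ge0 a : 0 <= ca_norm a.
Proof. exact: nrm_ge0 (@ca_normP R A) a. Qed.

Lemma ca_norm_star a : ca_norm (ca_star a) = ca_norm a.
Proof.
apply: (involution_isometry (@ca_starK R A) ca_norm_ge0) => b.
by rewrite -ca_normC ca_normM.
Qed.

Lemma ca_norm_mul_star a : ca_norm (ca_mul a (ca_star a)) = ca_norm a ^+ 2.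
Proof. by rewrite -{1}(ca_starK a) ca_normC ca_norm_star. Qed.

End CstarBasics.

(** * Positive elements of unital C*-algebras *)

Record UnitalCstarAlg (R : realType) := {
  uc_car :> algType R[i];
  uc_star : uc_car -> uc_car;
  uc_norm : uc_car -> R;
  uc_starD : forall a b, uc_star (a + b) = uc_star a + uc_star b;
  uc_starZ : forall (l : R[i]) a, uc_star (l *: a) = Num.conj l *: uc_star a;
  uc_starK : forall a, uc_star (uc_star a) = a;
  uc_starM : forall a b, uc_star (a * b) = uc_star b * uc_star a;
  uc_normP : is_norm uc_norm;
  uc_normM : forall a b, uc_norm (a * b) <= uc_norm a * uc_norm b;
  uc_normC : forall a, uc_norm (uc_star a * a) = uc_norm a ^+ 2;
  uc_complete : complete_for uc_norm
}.

HB.instance Definition _ (R : realType) (U : UnitalCstarAlg R) :=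
  GRing.isZmodMorphism.Build U U (@uc_star R U)
    (morphD_zmod_morphism (@uc_starD R U)).

Section VisserBound.
Variable R : realType.

Fixpoint visser_bound (n : nat) : R :=
  if n is m.+1 then (1 + visser_bound m ^+ 2) / 2 else 0.

Lemma visser_bound_ge0_le1 n : 0 <= visser_bound n <= 1.
Proof. by elim: n => [|n /andP[ge0 le1]] /=; [rewrite lexx ler01|nra]. Qed.

Lemma visser_bound_cvg :
  exists2 r : R, r <= 1 & visser_bound n @[n --> \oo] --> r.
Proof.
have bound_cvg : cvgn visser_bound.
  apply: nondecreasing_is_cvgn.
    apply/nondecreasing_seqP => n /=.
    by have := sqr_ge0 (1 - visser_bound n); nra.
  by exists 1 => _ [n _ <-]; case/andP: (visser_bound_ge0_le1 n).
exists (limn visser_bound) => //; apply: limr_le => //.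
by apply: nearW => n; case/andP: (visser_bound_ge0_le1 n).
Qed.

End VisserBound.

Section UnitalCstar.
Variables (R : realType) (U : UnitalCstarAlg R).
Local Notation norm := (@uc_norm R U).
Local Notation star := (@uc_star R U).
Local Notation normP := (@uc_normP R U).
Implicit Types (c e g h k p s w x y : U) (r t : R).

Lemma uc_starZ_real r x : star (r%:C *: x) = r%:C *: star x.
Proof. by rewrite uc_starZ conj_real. Qed.

Lemma uc_star1 : star 1 = 1.
Proof. by rewrite -[LHS]mulr1 -{2}(uc_starK 1) -uc_starM mulr1 uc_starK. Qed.

Lemma uc_starX2 x : star x = x -> star (x ^+ 2) = x ^+ 2.
Proof. by move=> sx; rewrite uc_starM sx. Qed.

Lemma uc_norm_ge0 x : 0 <= norm x.
Proof. exact: nrm_ge0 normP x. Qed.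

Lemma uc_norm_star x : norm (star x) = norm x.
Proof.
apply: (involution_isometry (@uc_starK R U) uc_norm_ge0) => y.
by rewrite -uc_normC uc_normM.
Qed.

Lemma uc_normX2 x : star x = x -> norm (x ^+ 2) = norm x ^+ 2.
Proof. by move=> sx; rewrite -uc_normC sx. Qed.

Lemma uc_norm1 : norm 1 = 1.
Proof.
have norm1_neq0 : norm 1 != 0 by rewrite gt_eqF // (nrm_gt0 normP) ?oner_neq0.
by apply: (mulfI norm1_neq0); rewrite -expr2 -uc_normC uc_star1 !mulr1.
Qed.

Lemma uc_ncvgM (u v : nat -> U) x y : ncvg norm u x -> ncvg norm v y ->
  ncvg norm (fun n => u n * v n) (x * y).
Proof.
apply: (ncvg_bilinear normP normP normP);
  [exact: mulrDl|exact: mulrDr|exact: uc_normM].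
Qed.

Lemma uc_ncvg_star (u : nat -> U) x : ncvg norm u x ->
  ncvg norm (star \o u) (star x).
Proof.
by rewrite /ncvg => ux; under eq_fun do rewrite -raddfB uc_norm_star.
Qed.

Fixpoint visser x (n : nat) : U :=
  if n is m.+1 then (2^-1)%:C *: (x + visser x m ^+ 2) else 0.

Lemma visser_comm x y n : GRing.comm y x -> GRing.comm y (visser x n).
Proof.
move=> yx; elim: n => [|n IH]; first exact: commr0.
rewrite /GRing.comm /= -scalerAl -scalerAr; congr (_ *: _).
exact: (commrD yx (commrX 2 IH)).
Qed.

Lemma visser_star x n : star x = x -> star (visser x n) = visser x n.
Proof.
move=> sx; elim: n => [|n IH] /=; first exact: raddf0.
by rewrite uc_starZ_real uc_starD sx uc_starX2.
Qed.

Lemma visser_norm_le x n : norm x <= 1 -> norm (visser x n) <= visser_bound R n.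
Proof.
move=> x_le1; elim: n => [|n IH] /=; first by rewrite (nrm0 normP).
rewrite (nrmZ_real normP) ?invr_ge0 // mulrC ler_pM2r ?invr_gt0 //.
apply: le_trans (ler_nrmD normP _ _) (lerD x_le1 _).
by apply: le_trans (uc_normM _ _) _; rewrite expr2 ler_pM ?uc_norm_ge0.
Qed.

Lemma visser_step_dist_le x v w : GRing.comm v w ->
  norm ((2^-1)%:C *: (x + v ^+ 2) - (2^-1)%:C *: (x + w ^+ 2))
    <= norm (v - w) * (norm v + norm w) / 2.
Proof.
move=> vw; rewrite -scalerBr opprD addrACA subrr add0r.
have -> : v ^+ 2 - w ^+ 2 = (v - w) * (v + w).
  by rewrite mulrBl !mulrDr -vw opprD addrA addrK.
rewrite (nrmZ_real normP) ?invr_ge0 // mulrC ler_pM2r ?invr_gt0 //.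
apply: le_trans (uc_normM _ _) _; rewrite ler_wpM2l ?uc_norm_ge0 //.
exact: ler_nrmD normP _ _.
Qed.

(* The scalar iteration started at [x = 1] dominates all increments. *)
Lemma visser_increment_le x n : norm x <= 1 ->
  norm (visser x n.+1 - visser x n) <= visser_bound R n.+1 - visser_bound R n.
Proof.
move=> x_le1; elim: n => [|n IH].
  rewrite /= !subr0 !expr2 !mul0r !addr0 mul1r (nrmZ_real normP) ?invr_ge0 //.
  by rewrite ler_piMr ?invr_ge0.
have comm_succ : GRing.comm (visser x n.+1) (visser x n).
  by apply: visser_comm; apply/commr_sym/visser_comm.
apply: le_trans (visser_step_dist_le x comm_succ) _.
have -> : visser_bound R n.+2 - visser_bound R n.+1
    = (visser_bound R n.+1 - visser_bound R n)
      * (visser_bound R n.+1 + visser_bound R n) / 2 by rewrite /=; field.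
rewrite ler_pM2r ?invr_gt0 // ler_pM ?addr_ge0 ?uc_norm_ge0 //.
by rewrite lerD ?visser_norm_le.
Qed.

Lemma visser_cvg x : norm x <= 1 ->
  exists2 s, ncvg norm (visser x) s & norm s <= 1.
Proof.
move=> x_le1; have [r r_le1 bound_cvg] := visser_bound_cvg R.
have [s xs s_le] := dominated_increments_ncvg normP (@uc_complete R U) bound_cvg
  (fun n => visser_increment_le n x_le1).
by exists s => //; move: s_le; rewrite !subr0 => /le_trans; exact.
Qed.

Lemma sqrt_complement x : star x = x -> norm x <= 1 ->
  exists s, [/\ star s = s, norm s <= 1, (1 - s) ^+ 2 = 1 - x &
    forall y, GRing.comm y x -> GRing.comm y s].
Proof.
move=> sx x_le1; have [s xs s_le1] := visser_cvg x_le1.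
have s_fix : s = (2^-1)%:C *: (x + s ^+ 2).
  apply: (ncvg_unique normP (u := visser x \o addn 1)).
    by apply: ncvg_subseq xs; exact: cvg_addnl.
  exact: (ncvgZ normP _ (ncvgD normP (ncvg_cst normP x) (uc_ncvgM xs xs))).
exists s; split => // [||y yx].
- apply: (ncvg_unique normP _ xs).
  have {1}-> : visser x = star \o visser x.
    by apply/funext => n; rewrite /= visser_star.
  exact: uc_ncvg_star xs.
- have two_s : s + s = x + s ^+ 2.
    by rewrite {1 2}s_fix -scalerDr scale_half_addr.
  have -> : x = s + s - s ^+ 2 by rewrite two_s addrK.
  by rewrite expr2 mulrBl mul1r mulrBr mulr1 -addrA -opprD addrA.
- apply: (ncvg_unique normP (u := fun n => y * visser x n)).
    exact: uc_ncvgM (ncvg_cst normP y) xs.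
  have -> : (fun n => y * visser x n) = (fun n => visser x n * y).
    by apply/funext => n; exact: visser_comm.
  exact: uc_ncvgM xs (ncvg_cst normP y).
Qed.

(* [k] is the real part of [k + i w], which is [t] times a unitary. *)
Lemma norm_le_circle k w t : 0 <= t -> star k = k -> star w = w ->
  GRing.comm k w -> k ^+ 2 + w ^+ 2 = (t ^+ 2)%:C%:A -> norm k <= t.
Proof.
move=> t_ge0 sk sw kw circle; pose u := k + 'i *: w.
have su : star u = k - 'i *: w.
  by rewrite uc_starD uc_starZ sk sw conjCi scaleNr.
have norm_u : norm u = t.
  apply/eqP; rewrite -(eqrXn2 (n := 2)) ?uc_norm_ge0 //; apply/eqP.
  rewrite -uc_normC su mulrBl !mulrDr -!scalerAl -!scalerAr scalerA.
  rewrite -['i * _]expr2 sqrCi kw scaleN1r opprD opprK addrA addrK circle.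
  by rewrite (nrmZ_real normP) ?sqr_ge0 // uc_norm1 mulr1.
have -> : k = (2^-1)%:C *: (u + star u).
  by rewrite su addrACA subrr addr0 scale_half_addr.
rewrite (nrmZ_real normP) ?invr_ge0 // ler_pdivrMl //.
apply: le_trans (ler_nrmD normP _ _) _.
by rewrite uc_norm_star norm_u -mulr2n mulr_natl.
Qed.

Lemma circle_complement k : star k = k -> exists w,
  [/\ star w = w, GRing.comm k w & k ^+ 2 + w ^+ 2 = (norm k ^+ 2)%:C%:A].
Proof.
move=> sk; have [->|k_neq0] := eqVneq k 0.
  exists 0; split; [exact: raddf0|exact: commr0|].
  by rewrite (nrm0 normP) !expr0n addr0 scale0r.
set t := norm k; have t_gt0 : 0 < t by rewrite (nrm_gt0 normP).
pose x := (t ^- 2)%:C *: k ^+ 2.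
have sx : star x = x by rewrite uc_starZ_real uc_starX2.
have x_le1 : norm x <= 1.
  rewrite (nrmZ_real normP) ?invr_ge0 ?sqr_ge0 // uc_normX2 //.
  by rewrite mulVf // gt_eqF ?exprn_gt0.
have [s [ss _ s_sqr s_comm]] := sqrt_complement sx x_le1.
have ks : GRing.comm k s.
  apply: s_comm; rewrite /GRing.comm -scalerAl -scalerAr; congr (_ *: _).
  exact: commrX.
exists (t%:C *: (1 - s)); split.
- by rewrite uc_starZ_real raddfB /= uc_star1 ss.
- rewrite /GRing.comm -scalerAl -scalerAr; congr (_ *: _).
  exact: commrB (commr1 k) ks.
- rewrite exprZn s_sqr -rmorphXn scalerBr scalerA -rmorphM /=.
  by rewrite mulfV ?scale1r ?subrKC // gt_eqF ?exprn_gt0.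
Qed.

Definition uc_pos h :=
  star h = h /\ exists2 t, 0 <= t & norm (t%:C%:A - h) <= t.

Lemma uc_posD h k : uc_pos h -> uc_pos k -> uc_pos (h + k).
Proof.
move=> [sh [t t_ge0 th]] [sk [r r_ge0 rk]].
split; first by rewrite uc_starD sh sk.
exists (t + r); first exact: addr_ge0.
rewrite rmorphD /= scalerDl opprD addrACA.
by apply: le_trans (ler_nrmD normP _ _) _; exact: lerD.
Qed.

Lemma uc_posZ r h : 0 <= r -> uc_pos h -> uc_pos (r%:C *: h).
Proof.
move=> r_ge0 [sh [t t_ge0 th]]; split; first by rewrite uc_starZ_real sh.
exists (r * t); first exact: mulr_ge0.
by rewrite rmorphM /= -scalerA -scalerBr (nrmZ_real normP) // ler_wpM2l.
Qed.

Lemma uc_posX2 k : star k = k -> uc_pos (k ^+ 2).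
Proof.
move=> sk; split; first exact: uc_starX2.
have [w [sw kw circle]] := circle_complement sk.
exists (norm k ^+ 2); first exact: sqr_ge0.
rewrite -circle addrC addKr uc_normX2 // lerXn2r ?nnegrE ?uc_norm_ge0 //.
apply: norm_le_circle sw sk (commr_sym kw) _; first exact: uc_norm_ge0.
by rewrite addrC.
Qed.

Lemma uc_pos_sqrt h : uc_pos h ->
  exists k, [/\ star k = k, uc_pos k, k ^+ 2 = h &
    forall y, GRing.comm y h -> GRing.comm y k].
Proof.
move=> [sh [t t_ge0 th]]; pose T := t + 1.
have T_gt0 : 0 < T by rewrite ltr_wpDl.
pose x := 1 - T^-1%:C *: h.
have sx : star x = x by rewrite raddfB /= uc_star1 uc_starZ_real sh.
have x_le1 : norm x <= 1.
  have -> : x = T^-1%:C *: ((t%:C%:A - h) + 1).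
    rewrite addrAC -[X in _ + X - h](scale1r 1) -scalerDl -rmorphD scalerBr.
    by rewrite scalerA -rmorphM /= mulVf ?gt_eqF // scale1r.
  rewrite (nrmZ_real normP) ?invr_ge0 ?(ltW T_gt0) // ler_pdivrMl // mulr1.
  by apply: le_trans (ler_nrmD normP _ _) _; rewrite uc_norm1 lerD2r.
have [s [ss s_le1 s_sqr s_comm]] := sqrt_complement sx x_le1.
have sk : star ((Num.sqrt T)%:C *: (1 - s)) = (Num.sqrt T)%:C *: (1 - s).
  by rewrite uc_starZ_real raddfB /= uc_star1 ss.
exists ((Num.sqrt T)%:C *: (1 - s)); split => // [||y yh].
- split=> //; exists (Num.sqrt T); first exact: sqrtr_ge0.
  by rewrite -scalerBr subKr (nrmZ_real normP) ?ler_piMr ?sqrtr_ge0.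
- rewrite exprZn -rmorphXn /= sqr_sqrtr ?(ltW T_gt0) // s_sqr subKr.
  by rewrite scalerA -rmorphM /= mulfV ?gt_eqF // scale1r.
- rewrite /GRing.comm -scalerAl -scalerAr; congr (_ *: _).
  apply: commrB (commr1 y) (s_comm _ _); apply: commrB (commr1 y) _.
  by rewrite /GRing.comm -scalerAl -scalerAr yh.
Qed.

Lemma uc_pos_normB p : uc_pos p -> uc_pos ((norm p)%:C%:A - p).
Proof.
case/uc_pos_sqrt => k [sk _ <- _]; rewrite uc_normX2 //.
have [w [sw _ <-]] := circle_complement sk.
by rewrite addrC addKr; exact: uc_posX2.
Qed.

Lemma uc_norm_le_posD h k : uc_pos h -> uc_pos k -> norm h <= norm (h + k).
Proof.
move=> h_pos k_pos; set B := norm (h + k).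
have B_ge0 : 0 <= B by exact: uc_norm_ge0.
have : uc_pos (B%:C%:A - h).
  have := uc_posD (uc_pos_normB (uc_posD h_pos k_pos)) k_pos.
  by rewrite opprD addrA subrK.
have [m [sm _ m_sqr _]] := uc_pos_sqrt h_pos.
case/uc_pos_sqrt => v [sv _ v_sqr v_comm].
rewrite -m_sqr uc_normX2 // -[leRHS](sqr_sqrtr B_ge0).
rewrite lerXn2r ?nnegrE ?uc_norm_ge0 ?sqrtr_ge0 //.
apply: norm_le_circle (sqrtr_ge0 _) sm sv (v_comm _ _) _; last first.
  by rewrite m_sqr v_sqr subrKC sqr_sqrtr.
apply: commrB; last by rewrite -m_sqr; exact: commrX.
by rewrite /GRing.comm mulr_algl mulr_algr.
Qed.

Lemma uc_posD_eq0 h k : uc_pos h -> uc_pos k -> h + k = 0 -> h = 0.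
Proof.
move=> h_pos k_pos hk0; apply/(nrm_eq0 normP)/le_anti.
by rewrite uc_norm_ge0 -(nrm0 normP) -hk0 uc_norm_le_posD.
Qed.

Lemma uc_sqr_eq0 x : star x = x -> x ^+ 2 = 0 -> x = 0.
Proof.
move=> sx x20; apply/(nrm_eq0 normP)/eqP.
by rewrite -sqrf_eq0 -uc_normX2 // x20 (nrm0 normP).
Qed.

(* Cartesian form: [2 (c^* c + c c^* ) = (c + c^* )^2 + (i (c^* - c))^2]. *)
Lemma uc_pos_starM_add_Mstar c : uc_pos (star c * c + c * star c).
Proof.
pose x := c + star c; pose y := 'i *: (star c - c).
have sx : star x = x by rewrite uc_starD uc_starK addrC.
have sy : star y = y.
  by rewrite uc_starZ raddfB /= uc_starK conjCi scaleNr -scalerN opprB.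
have -> : star c * c + c * star c = (2^-1)%:C *: (x ^+ 2 + y ^+ 2).
  rewrite -[LHS]scale_half_addr exprZn sqrCi scaleN1r /x; congr (_ *: _).
  move: (star c) => d; rewrite !expr2 mulrBl !mulrBr mulrDl !mulrDr !opprB.
  rewrite [RHS]addrACA [c * c + _ + _]addrC subrKA.
  by rewrite [d * c + d * d]addrC [d * d + _ + _]addrC subrKA addrACA addrC.
by apply: uc_posZ; [rewrite invr_ge0|apply: uc_posD; exact: uc_posX2].
Qed.

(* For [f = e g], the squares [(g^2)^2 = - f^* f] and [(e e^* )^2 = - f f^*] sum
   to the opposite of a positive element. *)
Lemma uc_star_neg_sqr_eq0 e g : star g = g -> star e * e = - g ^+ 2 -> e = 0.
Proof.
move=> sg ee; pose f := e * g; pose p := e * star e.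
have sp : star p = p by rewrite uc_starM uc_starK.
have sg2 : star (g ^+ 2) = g ^+ 2 by exact: uc_starX2.
have star_f_f : star f * f = - (g ^+ 2) ^+ 2.
  rewrite uc_starM sg /f -mulrA (mulrA (star e)) ee mulNr mulrN.
  by rewrite -exprSr -exprS -exprM.
have f_star_f : f * star f = - p ^+ 2.
  rewrite uc_starM sg /f !mulrA -(mulrA e) -expr2 -[g ^+ 2]opprK -ee.
  by rewrite mulrN mulNr expr2 /p !mulrA.
have p_eq0 : p = 0.
  apply: (uc_sqr_eq0 sp); apply: uc_posD_eq0 (uc_posX2 sp)
    (uc_posD (uc_posX2 sg2) (uc_pos_starM_add_Mstar f)) _.
  by rewrite star_f_f f_star_f [X in _ + X]addrA subrr add0r subrr.
apply/(nrm_eq0 normP)/eqP; rewrite -uc_norm_star -sqrf_eq0 -uc_normC uc_starK.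
by rewrite -/p p_eq0 (nrm0 normP).
Qed.

(* Kaplansky: with [h = c^* c] and [d = |h| - h], the element [e = c d] has
   [e^* e = d h d = - |h| d^2], so [d h = 0] and [h = |h|]. *)
Lemma uc_pos_starM c : uc_pos (star c * c).
Proof.
set h := star c * c.
have sh : star h = h by rewrite uc_starM uc_starK.
have [r [sr r_pos r_sqr r_comm]] := uc_pos_sqrt (uc_posX2 sh).
have [q [sq _ q_sqr q_comm]] := uc_pos_sqrt r_pos.
have hr : GRing.comm h r by apply: r_comm; exact: commrX.
pose d := r - h.
have sd : star d = d by rewrite raddfB /= sr sh.
have dr : GRing.comm d r by apply/commr_sym/commrB.
have dq : GRing.comm d q by exact: q_comm.
have hd : h * d = - (r * d).
  by rewrite !mulrBr -!expr2 r_sqr -hr opprB.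
have cd_eq0 : c * d = 0.
  apply: (uc_star_neg_sqr_eq0 (g := q * d)); first by rewrite uc_starM sq sd.
  rewrite uc_starM sd mulrA -(mulrA d) -/h -mulrA hd mulrN.
  by rewrite exprMn_comm ?q_sqr; [rewrite mulrA dr expr2 mulrA|exact/commr_sym].
have hd_eq0 : h * d = 0 by rewrite /h -mulrA cd_eq0 mulr0.
suff d_eq0 : d = 0 by rewrite -(subr0_eq d_eq0).
apply: uc_sqr_eq0 sd _.
by rewrite expr2 {1}/d mulrBl -[r * d]opprK -hd hd_eq0 oppr0 addr0.
Qed.

Lemma uc_pos_conj c h : uc_pos h -> uc_pos (star c * h * c).
Proof.
case/uc_pos_sqrt => k [sk _ <- _].
have -> : star c * k ^+ 2 * c = star (k * c) * (k * c).
  by rewrite uc_starM sk !mulrA.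
exact: uc_pos_starM.
Qed.

End UnitalCstar.

(** * Unitization *)

Definition unitz (R : realType) (A : CstarAlg R) : Type := (R[i]^o * A)%type.

HB.instance Definition _ (R : realType) (A : CstarAlg R) :=
  GRing.Lmodule.on (unitz A).

Section UnitizationAlgebra.
Variables (R : realType) (A : CstarAlg R).
Implicit Types (b c : A) (x y z : unitz A) (k : R[i]).

Definition unitz_act x b : A := x.1 *: b + ca_mul x.2 b.

Definition unitz_mul x y : unitz A :=
  (x.1 * y.1 : R[i]^o, y.1 *: x.2 + unitz_act x y.2).

Definition unitz_one : unitz A := (1 : R[i]^o, 0).

Definition unitz_star x : unitz A := (Num.conj x.1 : R[i]^o, ca_star x.2).

Lemma unitz_actDl x y b : unitz_act (x + y) b = unitz_act x b + unitz_act y b.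
Proof. by rewrite /unitz_act scalerDl ca_mulDl addrACA. Qed.

Lemma unitz_actDr x b c : unitz_act x (b + c) = unitz_act x b + unitz_act x c.
Proof. by rewrite /unitz_act scalerDr ca_mulDr addrACA. Qed.

Lemma unitz_actZl k x b : unitz_act (k *: x) b = k *: unitz_act x b.
Proof. by rewrite /unitz_act scalerDr scalerA ca_mulZl. Qed.

Lemma unitz_actZr k x b : unitz_act x (k *: b) = k *: unitz_act x b.
Proof. by rewrite /unitz_act scalerDr !scalerA ca_mulZr mulrC. Qed.

Lemma unitz_actM x y b :
  unitz_act (unitz_mul x y) b = unitz_act x (unitz_act y b).
Proof.
rewrite [unitz_act y b]/unitz_act unitz_actDr unitz_actZr /unitz_act /=.
rewrite !(ca_mulDl, ca_mulDr, ca_mulZl, ca_mulZr, scalerDr, scalerA) ca_mulA.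
by rewrite [y.1 * _]mulrC -!addrA; congr (_ + _); rewrite addrCA.
Qed.

Lemma unitz_act_adjoint x b c :
  ca_mul (ca_star (unitz_act x b)) c
    = ca_mul (ca_star b) (unitz_act (unitz_star x) c).
Proof.
rewrite /unitz_act /= ca_starD ca_starZ ca_starM ca_mulDl ca_mulDr.
by rewrite ca_mulZl ca_mulZr ca_mulA.
Qed.

Lemma unitz_mulA : associative unitz_mul.
Proof.
move=> x y z; congr pair; first exact: mulrA.
rewrite unitz_actM /= unitz_actDr unitz_actZr [in RHS]scalerDr scalerA addrA.
by congr (_ *: _ + _ + _); exact: mulrC.
Qed.

Lemma unitz_mul1r : left_id unitz_one unitz_mul.
Proof.
case=> l a; rewrite /unitz_mul /unitz_act /=.
by rewrite mul1r scale1r scaler0 ca_mul0r addr0 add0r.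
Qed.

Lemma unitz_mulr1 : right_id unitz_one unitz_mul.
Proof.
case=> l a; rewrite /unitz_mul /unitz_act /=.
by rewrite mulr1 scale1r scaler0 ca_mulr0 !addr0.
Qed.

Lemma unitz_mulDl : left_distributive unitz_mul +%R.
Proof.
move=> x y z; congr pair; first exact: mulrDl.
by rewrite /= unitz_actDl scalerDr addrACA.
Qed.

Lemma unitz_mulDr : right_distributive unitz_mul +%R.
Proof.
move=> x y z; congr pair; first exact: mulrDr.
by rewrite /= unitz_actDr scalerDl addrACA.
Qed.

Lemma unitz_one_neq0 : unitz_one != 0.
Proof. by apply/eqP => -[/eqP]; rewrite oner_eq0. Qed.

HB.instance Definition _ := GRing.Zmodule_isNzRing.Build (unitz A)
  unitz_mulA unitz_mul1r unitz_mulr1 unitz_mulDl unitz_mulDr unitz_one_neq0.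

Lemma unitz_scalerAl k x y : k *: (x * y) = k *: x * y.
Proof.
congr pair; first exact: mulrA.
by rewrite unitz_actZl !scalerDr !scalerA mulrC.
Qed.

HB.instance Definition _ :=
  GRing.Lmodule_isLalgebra.Build R[i] (unitz A) unitz_scalerAl.

Lemma unitz_scalerAr k x y : k *: (x * y) = x * (k *: y).
Proof.
congr pair; first exact: mulrCA.
by rewrite unitz_actZr scalerDr scalerA.
Qed.

HB.instance Definition _ :=
  GRing.Lalgebra_isAlgebra.Build R[i] (unitz A) unitz_scalerAr.

Lemma unitz_starD x y : unitz_star (x + y) = unitz_star x + unitz_star y.
Proof. by congr pair; [exact: rmorphD|exact: ca_starD]. Qed.

Lemma unitz_starZ k x : unitz_star (k *: x) = Num.conj k *: unitz_star x.
Proof. by congr pair; [exact: rmorphM|exact: ca_starZ]. Qed.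

Lemma unitz_starK x : unitz_star (unitz_star x) = x.
Proof. by case: x => l a; rewrite /unitz_star /= conjCK ca_starK. Qed.

Lemma unitz_starM x y : unitz_star (x * y) = unitz_star y * unitz_star x.
Proof.
congr pair => /=; first by rewrite rmorphM mulrC.
by rewrite /unitz_act !ca_starD !ca_starZ ca_starM addrCA.
Qed.

End UnitizationAlgebra.

Section UnitizationNorm.
Variables (R : realType) (A : CstarAlg R).
Local Notation norm := (@ca_norm R A).
Local Notation normP := (@ca_normP R A).
Implicit Types (a b : A) (x y : unitz A).

Definition unitz_bound x (M : R) :=
  cabs x.1 <= M /\ forall b, norm (unitz_act x b) <= M * norm b.

(* The infimum runs over common bounds of the scalar part and of left
   multiplication, so that the result is a norm even if [A] is unital. *)
Definition unitz_norm x : R := inf [set M | unitz_bound x M].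

Lemma unitz_bound_sum x : unitz_bound x (cabs x.1 + norm x.2).
Proof.
split=> [|b]; first by rewrite lerDl ca_norm_ge0.
apply: le_trans (ler_nrmD normP _ _) _; rewrite (nrmZ normP) mulrDl lerD2l.
exact: ca_normM.
Qed.

Lemma unitz_norm_le x M : unitz_bound x M -> unitz_norm x <= M.
Proof. by move=> xM; apply: ge_inf => //; exists (cabs x.1) => m []. Qed.

Lemma unitz_normP x : unitz_bound x (unitz_norm x).
Proof.
have bound_neq0 : [set M | unitz_bound x M] !=set0.
  by exists (cabs x.1 + norm x.2); exact: unitz_bound_sum.
split=> [|b]; first by apply: lb_le_inf => // M [].
have [->|b_neq0] := eqVneq b 0.
  by rewrite /unitz_act scaler0 ca_mulr0 addr0 (nrm0 normP) mulr0.
rewrite -ler_pdivrMr ?(nrm_gt0 normP) //; apply: lb_le_inf => // M [_ /(_ b)].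
by rewrite ler_pdivrMr ?(nrm_gt0 normP).
Qed.

Lemma cabs_le_unitz_norm x : cabs x.1 <= unitz_norm x.
Proof. by case: (unitz_normP x). Qed.

Lemma unitz_norm_act_le x b : norm (unitz_act x b) <= unitz_norm x * norm b.
Proof. by case: (unitz_normP x). Qed.

Lemma unitz_norm_ge0 x : 0 <= unitz_norm x.
Proof. exact: le_trans (cabs_ge0 _) (cabs_le_unitz_norm x). Qed.

Lemma ca_norm_le_unitz_norm x : norm x.2 <= 2 * unitz_norm x.
Proof.
have [->|x2_neq0] := eqVneq x.2 0.
  by rewrite (nrm0 normP) mulr_ge0 // unitz_norm_ge0.
have x2_gt0 := nrm_gt0 normP x2_neq0.
rewrite -(ler_pM2r x2_gt0) -expr2 -ca_norm_mul_star.
have -> : ca_mul x.2 (ca_star x.2)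
    = unitz_act x (ca_star x.2) - x.1 *: ca_star x.2 by rewrite addrC addKr.
apply: le_trans (ler_nrmB normP _ _) _.
rewrite (nrmZ normP) mulr_natl mulr2n mulrDl -(ca_norm_star x.2) lerD //.
  exact: unitz_norm_act_le.
by rewrite ler_wpM2r ?ca_norm_ge0 ?cabs_le_unitz_norm.
Qed.

Lemma unitz_normM x y : unitz_norm (x * y) <= unitz_norm x * unitz_norm y.
Proof.
apply: unitz_norm_le; split=> [|b].
  by rewrite cabsM ler_pM ?cabs_ge0 ?cabs_le_unitz_norm.
rewrite unitz_actM; apply: le_trans (unitz_norm_act_le _ _) _; rewrite -mulrA.
by rewrite ler_wpM2l ?unitz_norm_ge0 ?unitz_norm_act_le.
Qed.

Lemma unitz_norm_sqr_le x : unitz_norm x ^+ 2 <= unitz_norm (unitz_star x * x).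
Proof.
set N := unitz_norm (unitz_star x * x).
have N_ge0 : 0 <= N by exact: unitz_norm_ge0.
suff norm_le : unitz_norm x <= Num.sqrt N.
  by rewrite -[leRHS]sqr_sqrtr // lerXn2r ?nnegrE ?sqrtr_ge0 ?unitz_norm_ge0.
apply: unitz_norm_le; split=> [|b].
  rewrite -[leLHS]ger0_norm ?cabs_ge0 // -sqrtr_sqr ler_sqrt //.
  by apply: le_trans (cabs_le_unitz_norm _); rewrite cabsM cabsJ.
rewrite -(ler_pXn2r (n := 2)) ?nnegrE ?mulr_ge0 ?ca_norm_ge0 ?sqrtr_ge0 //.
rewrite exprMn sqr_sqrtr // -ca_normC unitz_act_adjoint -unitz_actM.
apply: le_trans (ca_normM _ _) _; rewrite ca_norm_star mulrC expr2 mulrA.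
by rewrite ler_wpM2r ?ca_norm_ge0 ?unitz_norm_act_le.
Qed.

Lemma unitz_normC x : unitz_norm (unitz_star x * x) = unitz_norm x ^+ 2.
Proof.
have norm_star : unitz_norm (unitz_star x) = unitz_norm x.
  apply: (involution_isometry (@unitz_starK R A) unitz_norm_ge0) => y.
  exact: le_trans (unitz_norm_sqr_le y) (unitz_normM _ _).
apply/le_anti; rewrite unitz_norm_sqr_le andbT.
by apply: le_trans (unitz_normM _ _) _; rewrite norm_star expr2.
Qed.

Lemma unitz_normZ_le (k : R[i]) x :
  unitz_norm (k *: x) <= cabs k * unitz_norm x.
Proof.
apply: unitz_norm_le; split=> [|b].
  by rewrite cabsM ler_wpM2l ?cabs_ge0 ?cabs_le_unitz_norm.
rewrite unitz_actZl (nrmZ normP) -mulrA ler_wpM2l ?cabs_ge0 //.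
exact: unitz_norm_act_le.
Qed.

Lemma unitz_norm_is_norm : is_norm unitz_norm.
Proof.
split=> [||x y|k x]; first exact: unitz_norm_ge0.
- move=> [l a] norm_eq0; congr pair.
    apply/eqP; rewrite -cabs_eq0 eq_le cabs_ge0 andbT -norm_eq0.
    exact: cabs_le_unitz_norm (l, a).
  apply/(nrm_eq0 normP)/le_anti; rewrite ca_norm_ge0 andbT.
  by have := ca_norm_le_unitz_norm (l, a); rewrite norm_eq0 mulr0.
- apply: unitz_norm_le; split=> [|b].
    by apply: le_trans (le_normcD _ _) _; rewrite lerD ?cabs_le_unitz_norm.
  rewrite unitz_actDl mulrDl; apply: le_trans (ler_nrmD normP _ _) _.
  by rewrite lerD ?unitz_norm_act_le.
- apply/le_anti; rewrite unitz_normZ_le /=.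
  have [->|k_neq0] := eqVneq k 0.
    by rewrite cabs0 mul0r unitz_norm_ge0.
  have k_gt0 : 0 < cabs k by rewrite lt_def cabs_eq0 k_neq0 cabs_ge0.
  have := unitz_normZ_le k^-1 (k *: x); rewrite scalerA mulVf // scale1r.
  by rewrite cabsV ler_pdivlMl.
Qed.

Lemma unitz_norm_complete : complete_for unitz_norm.
Proof.
move=> u u_cauchy.
have [|l /(ncvgP (cabs_is_norm R)) ul] := @cabs_complete R (fun n => (u n).1).
  move=> e /u_cauchy[N u_near]; exists N => m n Nm Nn.
  exact: le_lt_trans (cabs_le_unitz_norm (u m - u n)) (u_near _ _ Nm Nn).
have [|a /(ncvgP normP) ua] := @ca_complete R A (fun n => (u n).2).
  move=> e e0; have /u_cauchy[N u_near] : 0 < e / 2 by rewrite divr_gt0.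
  exists N => m n Nm Nn; have := u_near _ _ Nm Nn.
  rewrite ltr_pdivlMr // mulrC; apply: le_lt_trans.
  exact: ca_norm_le_unitz_norm (u m - u n).
exists (l, a); apply/(ncvgP unitz_norm_is_norm).
apply: (ncvg_le_dist unitz_norm_is_norm
  (d := fun n => cabs ((u n).1 - l) + norm ((u n).2 - a))) => [|n].
  by rewrite -[0]addr0; exact: cvgD ul ua.
exact: unitz_norm_le (unitz_bound_sum (u n - (l, a))).
Qed.

Definition unitization : UnitalCstarAlg R :=
  Build_UnitalCstarAlg (@unitz_starD R A) (@unitz_starZ R A) (@unitz_starK R A)
    (@unitz_starM R A) unitz_norm_is_norm unitz_normM unitz_normC
    unitz_norm_complete.

Definition unitz_emb a : unitization := (0 : R[i]^o, a).

Lemma unitz_embB a b : unitz_emb (a - b) = unitz_emb a - unitz_emb b.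
Proof. by congr pair; rewrite subr0. Qed.

Lemma unitz_embZ (k : R[i]) a : unitz_emb (k *: a) = k *: unitz_emb a.
Proof. by congr pair; rewrite scaler0. Qed.

Lemma unitz_embM a b : unitz_emb (ca_mul a b) = unitz_emb a * unitz_emb b.
Proof.
by congr pair; rewrite /= ?mul0r // /unitz_act !scale0r !add0r.
Qed.

Lemma unitz_emb_star a : unitz_emb (ca_star a) = uc_star (unitz_emb a).
Proof. by congr pair; rewrite rmorph0. Qed.

Lemma unitz_emb_norm a : uc_norm (unitz_emb a) = norm a.
Proof.
apply/le_anti/andP; split.
  apply: le_trans (unitz_norm_le (unitz_bound_sum _)) _.
  by rewrite cabs0 add0r.
have [->|a_neq0] := eqVneq a 0; first by rewrite (nrm0 normP) unitz_norm_ge0.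
rewrite -(ler_pM2r (nrm_gt0 normP a_neq0)) -expr2 -ca_norm_mul_star.
rewrite -(ca_norm_star a); have := unitz_norm_act_le (unitz_emb a) (ca_star a).
by rewrite /unitz_act scale0r add0r.
Qed.

End UnitizationNorm.

(** * Hilbert modules *)

Section HilbertModule.
Variables (R : realType) (A : CstarAlg R) (X : HilbMod A).
Local Notation norm := (@ca_norm R A).
Local Notation normP := (@ca_normP R A).
Local Notation ip := (@hm_ip R A X).
Implicit Types (x y z : X) (a : A).

Lemma hm_ipBl x y z : ip (x - y) z = ip x z - ip y z.
Proof. by rewrite hm_ipDl -scaleN1r hm_ipZl scaleN1r. Qed.

Lemma hm_ipDr x y z : ip x (y + z) = ip x y + ip x z.
Proof. by rewrite -hm_ipC hm_ipDl ca_starD !hm_ipC. Qed.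

Lemma hm_ipZr (l : R[i]) x y : ip x (l *: y) = Num.conj l *: ip x y.
Proof. by rewrite -hm_ipC hm_ipZl ca_starZ hm_ipC. Qed.

Lemma hm_ipBr x y z : ip x (y - z) = ip x y - ip x z.
Proof. by rewrite -hm_ipC hm_ipBl raddfB /= !hm_ipC. Qed.

Lemma hm_ip_actr a x y : ip x (hm_act a y) = ca_mul (ip x y) (ca_star a).
Proof. by rewrite -hm_ipC hm_ipA ca_starM hm_ipC. Qed.

Lemma hm_act_ipZ (l : R[i]) x y z : Num.conj l = l ->
  hm_act (ip (l *: x) (l *: y)) (l *: z) = l ^+ 3 *: hm_act (ip x y) z.
Proof.
move=> l_real; rewrite hm_ipZl hm_ipZr l_real hm_actZr !hm_actZl !scalerA.
by rewrite !exprS mulr1 mulrA.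
Qed.

Lemma uc_pos_ip x : uc_pos (unitz_emb (ip x x)).
Proof.
have [b ->] := hm_ip_pos x.
by rewrite unitz_embM unitz_emb_star; exact: uc_pos_starM.
Qed.

(* Positivity of [<z, z>] for [z = <y, x> x - t y] with [t = ||<x, x>||]. *)
Lemma ip_norm_sqr_le x y : norm (ip x y) ^+ 2 <= norm (ip x x) * norm (ip y y).
Proof.
have [->|x_neq0] := eqVneq x 0.
  by rewrite -(scale0r y) !hm_ipZl !scale0r (nrm0 normP) expr0n mul0r.
set t := norm (ip x x).
have t_gt0 : 0 < t.
  by rewrite (nrm_gt0 normP) //; apply: contra_neq x_neq0 => /hm_ip_def.
pose c := unitz_emb (ip x y); pose p := unitz_emb (ip x x).
pose z := hm_act (ip y x) x - t%:C *: y.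
have star_c : uc_star c = unitz_emb (ip y x) by rewrite -unitz_emb_star hm_ipC.
have emb_zz : unitz_emb (ip z z) = uc_star c * (p * c - t%:C *: c)
    - t%:C *: (uc_star c * c - t%:C *: unitz_emb (ip y y)).
  rewrite hm_ipBl hm_ipA hm_ipZl !hm_ipBr !hm_ip_actr !hm_ipZr hm_ipC conj_real.
  by rewrite !(unitz_embB, unitz_embM, unitz_embZ) star_c.
have decomposition : (t * t)%:C *: unitz_emb (ip y y) = t%:C *: (uc_star c * c)
    + (uc_star c * (t%:C%:A - p) * c + unitz_emb (ip z z)).
  rewrite emb_zz mulrBr mulrBl mulrBr -!scalerAr mulr1 -scalerAl mulrA scalerBr.
  by rewrite scalerA -rmorphM opprB [X in _ + X]addrA subrKA subrr add0r subrKC.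
have tp_pos : uc_pos (t%:C%:A - p).
  by rewrite /t -unitz_emb_norm; exact/uc_pos_normB/uc_pos_ip.
have := uc_norm_le_posD (uc_posZ (ltW t_gt0) (uc_pos_starM c))
  (uc_posD (uc_pos_conj c tp_pos) (uc_pos_ip z)).
rewrite -decomposition !(nrmZ_real (@uc_normP _ _)) ?mulr_ge0 ?(ltW t_gt0) //.
by rewrite uc_normC !unitz_emb_norm -mulrA ler_pM2l.
Qed.

Lemma hnorm_sqr x : hnorm x ^+ 2 = norm (ip x x).
Proof. by rewrite sqr_sqrtr // ca_norm_ge0. Qed.

Lemma hnorm_ge0 x : 0 <= hnorm x.
Proof. exact: sqrtr_ge0. Qed.

Lemma ip_norm_le x y : norm (ip x y) <= hnorm x * hnorm y.
Proof.
rewrite -(ler_pXn2r (n := 2)) ?nnegrE ?mulr_ge0 ?hnorm_ge0 ?ca_norm_ge0 //.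
by rewrite exprMn !hnorm_sqr ip_norm_sqr_le.
Qed.

Lemma ler_hnormD x y : hnorm (x + y) <= hnorm x + hnorm y.
Proof.
rewrite -(ler_pXn2r (n := 2)) ?nnegrE ?addr_ge0 ?hnorm_ge0 // hnorm_sqr.
rewrite hm_ipDl !hm_ipDr sqrrD mulr2n !addrA -addrA.
have := ler_nrmD normP (ip x x + ip x y) (ip y x + ip y y).
have := ler_nrmD normP (ip x x) (ip x y).
have := ler_nrmD normP (ip y x) (ip y y).
by have := ip_norm_le x y; have := ip_norm_le y x; rewrite -!hnorm_sqr; lra.
Qed.

Lemma hnorm_is_norm : is_norm (@hnorm R A X).
Proof.
split=> [|x x0|x y|c x].
- exact: hnorm_ge0.
- by apply/hm_ip_def/(nrm_eq0 normP); rewrite -hnorm_sqr x0 expr0n.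
- exact: ler_hnormD.
- rewrite /hnorm hm_ipZl hm_ipZr !(nrmZ normP) cabsJ mulrA -expr2.
  by rewrite sqrtrM ?sqr_ge0 // sqrtr_sqr ger0_norm // cabs_ge0.
Qed.

Lemma hnorm_act_le a x : hnorm (hm_act a x) <= norm a * hnorm x.
Proof.
rewrite -(ler_pXn2r (n := 2)) ?nnegrE ?mulr_ge0 ?hnorm_ge0 ?ca_norm_ge0 //.
rewrite exprMn !hnorm_sqr hm_ip_actr hm_ipA.
apply: le_trans (ca_normM _ _) _; rewrite ca_norm_star expr2 mulrAC.
by rewrite ler_wpM2r ?ca_norm_ge0 // ca_normM.
Qed.

End HilbertModule.

(** * The direct method *)

Section UnimodularLinear.
Variables (R : realType) (X Y : lmodType R[i]) (H : X -> Y).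
Hypothesis H_unimodular : forall (mu : R[i]) x y, cabs mu = 1 ->
  H (mu *: x + y) = mu *: H x + H y.

Lemma unimodular_additive : {morph H : x y / x + y}.
Proof. by move=> x y; have := H_unimodular x y (cabs1 R); rewrite !scale1r. Qed.

Lemma unimodularMn n : {morph H : x / x *+ n}.
Proof.
have H0 : H 0 = 0 by apply: (addrI (H 0)); rewrite -unimodular_additive !addr0.
move=> x; elim: n => [|n IH]; first by rewrite !mulr0n.
by rewrite !mulrS unimodular_additive IH.
Qed.

Lemma unimodularZ mu x : cabs mu = 1 -> H (mu *: x) = mu *: H x.
Proof.
by move=> /(H_unimodular x 0); rewrite -(mulr0n 0) unimodularMn !mulr0n !addr0.
Qed.

(* For large [n], [r / n] is a sum of two unimodular numbers. *)
Lemma unimodularZ_real (r : R) x : H (r%:C *: x) = r%:C *: H x.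
Proof.
pose n := Num.bound `|r|.
have r_lt : `|r| < n%:R := archi_boundP (normr_ge0 r).
have n_gt0 : 0 < n%:R :> R := le_lt_trans (normr_ge0 r) r_lt.
have [|mu [nu [mu1 nu1 rE]]] := @real_sum_unimodular R (r / n%:R).
  rewrite normf_div (ger0_norm (ltW n_gt0)) ler_pdivrMr //; lra.
have -> : r%:C = (mu + nu) *+ n.
  by rewrite -rE -rmorphMn /= -mulr_natr divfK ?gt_eqF.
rewrite -!scalerMnl unimodularMn !scalerDl unimodular_additive.
by rewrite !unimodularZ.
Qed.

Lemma unimodular_linear : linear H.
Proof.
move=> l x y; rewrite unimodular_additive (complexE l) !scalerDl.
rewrite unimodular_additive -!scalerA (unimodularZ _ (cabsi R)).
by rewrite !unimodularZ_real.
Qed.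

End UnimodularLinear.

Lemma halving_bound (R : realType) (V : lmodType R[i]) (psi : V -> R) (q : R) :
  0 <= q -> (forall x, psi x <= q * psi (2 *: x)) ->
  forall n x, psi (2 ^- n *: x) <= q ^+ n * psi x.
Proof.
move=> q_ge0 psi_le n; elim: n => [|n IH] x.
  by rewrite expr0 invr1 scale1r mul1r.
apply: le_trans (psi_le _) _.
rewrite scalerA exprS invfM mulrA mulfV ?pnatr_eq0 // mul1r exprS -mulrA.
by rewrite ler_wpM2l.
Qed.

Lemma cabs_pow2 (R : realType) n : cabs ((2 : R[i]) ^+ n) = 2 ^+ n.
Proof. by rewrite -natrX cabs_nat natrX. Qed.

Lemma conj_pow2 (R : realType) n : Num.conj ((2 : R[i]) ^+ n) = 2 ^+ n.
Proof. by rewrite -natrX conjC_nat. Qed.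

Lemma pow2_neq0 (R : realType) n : (2 : R[i]) ^+ n != 0.
Proof. by rewrite expf_neq0 // pnatr_eq0. Qed.

Definition dyadic_rescaling (R : realType) (X Y : lmodType R[i]) (f : X -> Y)
  (x : X) (n : nat) : Y := 2 ^+ n *: f (2 ^- n *: x).

Section LinearStability.
Variables (R : realType) (X Y : lmodType R[i]) (nrm : Y -> R) (f : X -> Y).
Variables (phi : X -> X -> R) (q : R).
Hypotheses (nrmP : is_norm nrm) (q_ge0 : 0 <= q) (q_lt : 2 * q < 1).
Hypothesis phi_le : forall x y, phi x y <= q * phi (2 *: x) (2 *: y).
Hypothesis f_le : forall (mu : R[i]) x y, cabs mu = 1 ->
  nrm (f (mu *: x + y) - mu *: f x - f y) <= phi x y.

Lemma rescaled_bound_le n x y :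
  2 ^+ n * phi (2 ^- n *: x) (2 ^- n *: y) <= (2 * q) ^+ n * phi x y.
Proof.
rewrite exprMn -mulrA ler_wpM2l ?exprn_ge0 //.
exact: (@halving_bound _ (X * X)%type (fun xy => phi xy.1 xy.2) q q_ge0
  (fun xy => phi_le xy.1 xy.2) n (x, y)).
Qed.

Lemma cvg_rescaled_bound (K : R) : K * (2 * q) ^+ n @[n --> \oo] --> 0.
Proof. by apply: cvg_geometric; rewrite ger0_norm ?mulr_ge0. Qed.

Lemma dyadic_increment_le x n :
  nrm (dyadic_rescaling f x n.+1 - dyadic_rescaling f x n)
    <= q * phi x x * (2 * q) ^+ n.
Proof.
pose w := 2 ^- n.+1 *: x.
have ww : 1 *: w + w = 2 ^- n *: x.
  rewrite scale1r -mulr2n -scaler_nat scalerA exprS invfM mulrA.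
  by rewrite mulfV ?mul1r // pnatr_eq0.
have -> : dyadic_rescaling f x n.+1 - dyadic_rescaling f x n
    = - (2 ^+ n *: (f (1 *: w + w) - 1 *: f w - f w)).
  rewrite ww scale1r -addrA -opprD -mulr2n -[f w *+ 2]scaler_nat scalerBr.
  by rewrite scalerA -exprSr opprB.
rewrite (nrmN nrmP) (nrmZ nrmP) cabs_pow2.
apply: le_trans (ler_wpM2l _ (f_le w w (cabs1 R))) _; first exact: exprn_ge0.
have := rescaled_bound_le n.+1 x x; rewrite -/w !exprS; lra.
Qed.

Lemma dyadic_rescaling_cvg x : complete_for nrm ->
  exists2 y, ncvg nrm (dyadic_rescaling f x) y
           & nrm (f x - y) <= q / (1 - 2 * q) * phi x x.
Proof.
move=> nrmC; set K := q / (1 - 2 * q) * phi x x.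
have d_cvg : - K * (2 * q) ^+ n @[n --> \oo] --> 0 by exact: cvg_rescaled_bound.
have incrementE n : q * phi x x * (2 * q) ^+ n
    = - K * (2 * q) ^+ n.+1 - - K * (2 * q) ^+ n.
  by rewrite exprS /K; field; rewrite gt_eqF ?subr_gt0.
have [n|y y_lim y_le] := dominated_increments_ncvg nrmP nrmC d_cvg
    (u := dyadic_rescaling f x).
  by rewrite -incrementE dyadic_increment_le.
exists y => //; move: y_le.
rewrite /dyadic_rescaling expr0 invr1 !scale1r mulr1 sub0r opprK.
by rewrite (nrm_distC nrmP).
Qed.

Lemma dyadic_limit_linear (H : X -> Y) :
  (forall x, ncvg nrm (dyadic_rescaling f x) (H x)) -> linear H.
Proof.
move=> H_lim; apply: unimodular_linear => mu x y mu1.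
apply: (ncvg_eq nrmP (H_lim _) (ncvgD nrmP (ncvgZ nrmP mu (H_lim x)) (H_lim y))
  (cvg_rescaled_bound (phi x y))) => n.
have -> : dyadic_rescaling f (mu *: x + y) n
      - (mu *: dyadic_rescaling f x n + dyadic_rescaling f y n)
    = 2 ^+ n *: (f (mu *: (2 ^- n *: x) + 2 ^- n *: y)
                 - mu *: f (2 ^- n *: x) - f (2 ^- n *: y)).
  rewrite /dyadic_rescaling !scalerBr scalerDr !scalerA ![mu * _]mulrC.
  by rewrite opprD addrA.
rewrite (nrmZ nrmP) cabs_pow2.
apply: le_trans (ler_wpM2l _ (f_le _ _ mu1)) _; first exact: exprn_ge0.
by rewrite [leRHS]mulrC rescaled_bound_le.
Qed.

Lemma dyadic_limit_exists : complete_for nrm -> exists H : X -> Y,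
  [/\ linear H, forall x, ncvg nrm (dyadic_rescaling f x) (H x) &
    forall x, nrm (f x - H x) <= q / (1 - 2 * q) * phi x x].
Proof.
move=> nrmC; have /choice[H H_lim] : forall x, exists y,
    ncvg nrm (dyadic_rescaling f x) y
    /\ nrm (f x - y) <= q / (1 - 2 * q) * phi x x.
  by move=> x; have [y] := dyadic_rescaling_cvg x nrmC; exists y.
exists H; split=> [|x|x]; [|by case: (H_lim x)|by case: (H_lim x)].
by apply: dyadic_limit_linear => x; case: (H_lim x).
Qed.

Lemma dyadic_rescaling_cvg_linear (H : X -> Y) (K : R) : linear H -> 0 <= K ->
  (forall x, nrm (f x - H x) <= K * phi x x) ->
  forall x, ncvg nrm (dyadic_rescaling f x) (H x).
Proof.
move=> H_lin K_ge0 H_le x.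
apply: (ncvg_le_dist nrmP (cvg_rescaled_bound (K * phi x x))) => n.
have -> : dyadic_rescaling f x n - H x
    = 2 ^+ n *: (f (2 ^- n *: x) - H (2 ^- n *: x)).
  by rewrite scalerBr (scalable_linear H_lin) scalerA mulfV ?scale1r ?pow2_neq0.
rewrite (nrmZ nrmP) cabs_pow2.
apply: le_trans (ler_wpM2l _ (H_le _)) _; first exact: exprn_ge0.
rewrite mulrCA -[leRHS]mulrA ler_wpM2l // [leRHS]mulrC.
exact: rescaled_bound_le.
Qed.

End LinearStability.

Section ModuleStability.
Variables (R : realType) (A B : CstarAlg R) (X : HilbMod A) (Y : HilbMod B).

Lemma dyadic_rescaling_ip_act (f : X -> Y) x y z n :
  dyadic_rescaling f (hm_act (hm_ip x y) z) (n * 3)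
    - hm_act (hm_ip (dyadic_rescaling f x n) (dyadic_rescaling f y n))
        (dyadic_rescaling f z n)
  = 2 ^+ (n * 3) *:
    (f (hm_act (hm_ip (2 ^- n *: x) (2 ^- n *: y)) (2 ^- n *: z))
     - hm_act (hm_ip (f (2 ^- n *: x)) (f (2 ^- n *: y))) (f (2 ^- n *: z))).
Proof.
rewrite scalerBr !hm_act_ipZ ?fmorphV /= ?conj_pow2 //.
by rewrite exprVn -!exprM.
Qed.

Lemma dyadic_limit_ip_act (f H : X -> Y) (phi : X -> X -> X -> R) (q : R) :
  0 <= q -> 8 * q < 1 ->
  (forall x y z, phi x y z <= q * phi (2 *: x) (2 *: y) (2 *: z)) ->
  (forall x y z, hnorm (f (hm_act (hm_ip x y) z)
     - hm_act (hm_ip (f x) (f y)) (f z)) <= phi x y z) ->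
  (forall x, ncvg (@hnorm R B Y) (dyadic_rescaling f x) (H x)) ->
  forall x y z, H (hm_act (hm_ip x y) z) = hm_act (hm_ip (H x) (H y)) (H z).
Proof.
move=> q_ge0 q_lt phi_le f_le H_lim x y z; have nrmP := hnorm_is_norm Y.
have ip_lim := ncvg_bilinear nrmP nrmP (@ca_normP R B) (@hm_ipDl _ _ _)
  (@hm_ipDr _ _ _) (@ip_norm_le _ _ _) (H_lim x) (H_lim y).
have act_lim := ncvg_bilinear (@ca_normP R B) nrmP nrmP (@hm_actDl _ _ _)
  (@hm_actDr _ _ _) (@hnorm_act_le _ _ _) ip_lim (H_lim z).
have lim_act := ncvg_subseq (@cvg_mulnr 3 isT) (H_lim (hm_act (hm_ip x y) z)).
have bound_cvg : phi x y z * (8 * q) ^+ n @[n --> \oo] --> 0.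
  by apply: cvg_geometric; rewrite ger0_norm ?mulr_ge0.
apply: (ncvg_eq nrmP lim_act act_lim bound_cvg) => n.
rewrite [X in hnorm X]dyadic_rescaling_ip_act (nrmZ nrmP) cabs_pow2.
apply: le_trans (ler_wpM2l _ (f_le _ _ _)) _; first exact: exprn_ge0.
have pow8 : 2 ^+ (n * 3) = 8 ^+ n :> R by rewrite mulnC exprM -natrX.
rewrite pow8 [leRHS]mulrC exprMn -mulrA ler_wpM2l ?exprn_ge0 //.
exact: (@halving_bound _ (X * X * X)%type (fun v => phi v.1.1 v.1.2 v.2) q q_ge0
  (fun v => phi_le v.1.1 v.1.2 v.2) n (x, y, z)).
Qed.

Lemma is_hm_star_hom_of_hom (H : X -> Y) : is_hm_hom H -> is_hm_star_hom H.
Proof. by move=> H_hom; split=> // x y z; rewrite !hm_ipC; case: H_hom. Qed.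

End ModuleStability.

Lemma stability_constant_le (R : realFieldType) (L : R) : 0 <= L -> L < 1 ->
  L / 8 / (1 - 2 * (L / 8)) <= L / (8 - 8 * L).
Proof.
move=> L_ge0 L_lt1; rewrite (_ : 8 - 8 * L = 8 * (1 - L)); last by ring.
by rewrite invfM [leRHS]mulrA ler_wpM2l ?divr_ge0 // lef_pV2 ?posrE; lra.
Qed.

Theorem theorem3p3 (R : realType) (A B : CstarAlg R)
    (Xi : HilbMod A) (Nb : HilbMod B) (f : Xi -> Nb)
    (phi : Xi -> Xi -> Xi -> R) (L : R) :
  (forall x y z, 0 <= phi x y z) ->
  (forall (mu : R[i]) (x y : Xi), cabs mu = 1 ->
     hnorm (f (mu *: x + y) - mu *: f x - f y) <= phi x y 0) ->
  (forall x y z : Xi,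
     hnorm (f (hm_act (hm_ip x y) z) - hm_act (hm_ip (f x) (f y)) (f z))
       <= phi x y z) ->
  (forall x y z : Xi,
     hnorm (f (hm_act (ca_star (hm_ip x y)) z)
            - hm_act (ca_star (hm_ip (f x) (f y))) (f z))
       <= phi x y z) ->
  0 <= L -> L < 1 ->
  (forall x y z : Xi,
     phi x y z <= L / 8 * phi (2 *: x) (2 *: y) (2 *: z)) ->
  exists H : Xi -> Nb,
    (is_hm_star_hom H /\
     forall x, hnorm (f x - H x) <= L / (8 - 8 * L) * phi x x 0) /\
    (forall H' : Xi -> Nb,
       is_hm_star_hom H' /\
       (forall x, hnorm (f x - H' x) <= L / (8 - 8 * L) * phi x x 0) ->
       H' = H).
Proof.
move=> phi_ge0 f_linear_le f_ip_le _ L_ge0 L_lt1 phi_le.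
have q_ge0 : 0 <= L / 8 by rewrite divr_ge0.
have q2_lt1 : 2 * (L / 8) < 1 by lra.
have q8_lt1 : 8 * (L / 8) < 1 by lra.
have M_ge0 : 0 <= L / (8 - 8 * L) by rewrite divr_ge0 //; lra.
pose psi x y := phi x y 0.
have psi_le x y : psi x y <= L / 8 * psi (2 *: x) (2 *: y).
  by have := phi_le x y 0; rewrite scaler0.
have nrmP := hnorm_is_norm Nb.
have [H [H_lin H_lim H_le]] := dyadic_limit_exists nrmP q_ge0 q2_lt1 psi_le
  f_linear_le (@hm_complete R B Nb).
exists H; split; first split.
- apply: is_hm_star_hom_of_hom; split=> //.
  exact: dyadic_limit_ip_act q_ge0 q8_lt1 phi_le f_ip_le H_lim.
- move=> x; apply: le_trans (H_le x) _.
  by rewrite ler_wpM2r ?phi_ge0 ?stability_constant_le.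
- move=> H' [[[H'_lin _] _] H'_le]; apply/funext => x.
  apply: (ncvg_unique nrmP _ (H_lim x)).
  exact: (dyadic_rescaling_cvg_linear nrmP q_ge0 q2_lt1 psi_le H'_lin M_ge0).
Qed.
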